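(* If $h \ge 1$, then $\mu_t(Q_h) = 2\cdot A(h,4)$.
   Context: $Q_h$ is the hypercube with vertex set $\{0,1\}^h$, two strings adjacent iff they differ in exactly one position. For $M \subseteq V(G)$, a $u,v$-path is $M$-free if it contains no vertex of $M\setminus\{u,v\}$; $u,v$ are $M$-visible if there is an $M$-free shortest $u,v$-path. $M$ is a total mutual-visibility set if every $u,v\in V(G)$ are $M$-visible, and $\mu_t(G)$ is the maximum size of such a set. $A(n,d)$ is the maximum size of a set $C \subseteq \{0,1\}^n$ such that any two distinct elements of $C$ differ in at least $d$ positions. *)

(* Defs.v *)
From mathcomp Require Import all_boot.
From mathcomp Require Import boolp.

Set Implicit Arguments.
Unset Strict Implicit.
Unset Printing Implicit Defensive.

(* A finite simple graph is given by its adjacency relation, a symmetric and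
   irreflexive [e : rel T] on the finite vertex type [T]. *)
Section Visibility.
Variables (T : finType) (e : rel T).

(* The path from [u] to [v] with vertex sequence [u :: p]; its length (number
   of edges) is [size p]. *)
Definition uv_path (u v : T) (p : seq T) : bool :=
  [&& path e u p, last u p == v & uniq (u :: p)].

Definition shortest_path (u v : T) (p : seq T) : Prop :=
  uv_path u v p /\ forall q, uv_path u v q -> size p <= size q.

Definition path_free (M : {set T}) (u v : T) (p : seq T) : Prop :=
  forall x, x \in u :: p -> x \notin M :\: [set u; v].

Definition visible (M : {set T}) (u v : T) : Prop :=
  exists p, shortest_path u v p /\ path_free M u v p.

Definition total_mutual_visibility_set (M : {set T}) : Prop :=
  forall u v : T, visible M u v.

Definition mu_t : nat :=
  \max_(M : {set T} | `[< total_mutual_visibility_set M >]) #|M|.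

End Visibility.

Notation bitstring n := {ffun 'I_n -> bool}.

Definition hamming (n : nat) (x y : bitstring n) : nat :=
  #|[set i | x i != y i]|.

Definition hypercube (h : nat) : rel (bitstring h) :=
  fun x y => hamming x y == 1.

Lemma hypercube_sym (h : nat) : symmetric (@hypercube h).
Proof.
move=> x y; rewrite /hypercube /hamming; congr (_ == 1).
by apply: eq_card => i; rewrite !inE eq_sym.
Qed.

Lemma hypercube_irr (h : nat) : irreflexive (@hypercube h).
Proof.
move=> x; rewrite /hypercube /hamming (_ : [set i | _] = set0) ?cards0 //.
by apply/setP=> i; rewrite !inE eqxx.
Qed.

Definition code_distance_ge (n d : nat) (C : {set bitstring n}) : bool :=
  [forall x in C, forall y in C, (x != y) ==> (d <= hamming x y)].

(* The maximum size of a binary code of length [n] and minimum distance at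
   least [d]. *)
Definition A (n d : nat) : nat :=
  \max_(C : {set bitstring n} | code_distance_ge d C) #|C|.

(* Main.v *)
(** A set [M] of vertices of the hypercube is a total mutual-visibility set iff
    it contains no two vertices at distance 2.  Indeed, two vertices at distance
    2 are exactly the common neighbours of another pair at distance 2, whose
    shortest paths they block.  Conversely, the neighbours of [u] that are closer
    to [v] are pairwise at distance 2, so at most one of them lies in [M] and a
    greedy walk avoids [M].  Such an [M] splits by parity into two codes of
    minimum distance 4, and for such a code [C] the union of [C] with a translate
    of [C] by a unit vector has no two elements at distance 2. *)
Require Import Defs.
From mathcomp Require Import all_boot.
From mathcomp Require Import boolp.

Set Implicit Arguments.
Unset Strict Implicit.
Unset Printing Implicit Defensive.

Section Hamming.
Variable n : nat.
Implicit Types (x y z u v w : bitstring n) (i j : 'I_n).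

Definition flip x i : bitstring n := [ffun k => x k (+) (k == i)].

Definition parity x : bool := \big[addb/false]_i x i.

Lemma flipK x i : flip (flip x i) i = x.
Proof. by apply/ffunP=> k; rewrite !ffunE -addbA addbb addbF. Qed.

Lemma hamming_sum x y : hamming x y = \sum_i (x i != y i).
Proof. by rewrite /hamming cardsE -sum1_card big_mkcond. Qed.

Lemma hamming_sym x y : hamming x y = hamming y x.
Proof. by rewrite !hamming_sum; apply: eq_bigr => i _; rewrite eq_sym. Qed.

Lemma hamming_triangle x y z : hamming x z <= hamming x y + hamming y z.
Proof.
rewrite !hamming_sum -big_split; apply: leq_sum => i _ /=.
by case: (x i); case: (y i); case: (z i).
Qed.

Lemma hamming_eq0 x y : (hamming x y == 0) = (x == y).
Proof.
apply/idP/eqP => [|->]; last by rewrite hamming_sum big1 // => i _; rewrite eqxx.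
rewrite /hamming cards_eq0 => /eqP/setP h; apply/ffunP=> i.
by move: (h i); rewrite !inE => /negbFE/eqP.
Qed.

Lemma hamming_flipS x y i : x i != y i -> hamming x y = (hamming (flip x i) y).+1.
Proof.
move=> nxy; rewrite !hamming_sum (bigD1 i) //= nxy [in RHS](bigD1 i) //=.
rewrite ffunE eqxx (_ : _ (+) true != y i = false) ?add0n; last first.
  by move: nxy; case: (x i); case: (y i).
by rewrite add1n; congr _.+1; apply: eq_bigr => k /negbTE ki; rewrite ffunE ki addbF.
Qed.

Lemma hamming_gt0 x y : 0 < hamming x y -> exists i, x i != y i.
Proof. by case/card_gt0P=> i; rewrite inE; exists i. Qed.

Lemma hamming_flip2 x y i : hamming (flip x i) (flip y i) = hamming x y.
Proof.
rewrite !hamming_sum; apply: eq_bigr => k _; rewrite !ffunE.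
by case: (x k); case: (y k); case: (k == i).
Qed.

Lemma hamming_flip x i : hamming x (flip x i) = 1.
Proof.
rewrite (@hamming_flipS _ _ i); first by apply/eqP; rewrite eqSS hamming_eq0.
by rewrite ffunE eqxx addbT; case: (x i).
Qed.

Lemma hypercubeP x y : reflect (exists i, y = flip x i) (@hypercube n x y).
Proof.
apply: (iffP eqP) => [h|[i ->]]; last exact: hamming_flip.
have [|i nxy] := @hamming_gt0 x y; first by rewrite h.
exists i; apply/eqP; rewrite eq_sym -hamming_eq0.
by move: h; rewrite (hamming_flipS nxy) => -[->].
Qed.

Lemma hypercube_flip x i : @hypercube n x (flip x i).
Proof. by apply/hypercubeP; exists i. Qed.

Lemma hamming2P x y :
  reflect (exists i j, i != j /\ y = flip (flip x i) j) (hamming x y == 2).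
Proof.
apply: (iffP eqP) => [h|[i [j [nij ->]]]].
- have [|i nxy] := @hamming_gt0 x y; first by rewrite h.
  have /hypercubeP[j yE] : @hypercube n (flip x i) y.
    by move: h; rewrite /hypercube (hamming_flipS nxy) => -[->].
  exists i, j; split=> //; apply/eqP=> eij; move: nxy.
  by rewrite yE -eij flipK eqxx.
- rewrite (@hamming_flipS _ _ i) ?hamming_flip //.
  by rewrite !ffunE eqxx (negbTE nij) addbF addbT; case: (x i).
Qed.

(** Modulo 2, the indicator of [x i != y i] is the sum of the two bits. *)
Lemma odd_hamming x y : odd (hamming x y) = parity x (+) parity y.
Proof.
rewrite hamming_sum (big_morph odd oddD (erefl : odd 0 = false)) -big_split.
by apply: eq_bigr => i _ /=; case: (x i); case: (y i).
Qed.

(** Each edge contributes 1 in the triangle inequality. This lower bound certifies that a walk of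
    [hamming u v] steps is shortest. *)
Lemma hamming_path u p : path (@hypercube n) u p -> hamming u (last u p) <= size p.
Proof.
elim: p u => [|w p IH] u /=; first by rewrite leqn0 hamming_eq0.
case/andP=> /eqP uw /IH h.
by apply: leq_trans (hamming_triangle u w _) _; rewrite uw add1n.
Qed.

End Hamming.

Section TotalVisibility.
Variable n : nat.
Implicit Types (x y u v w : bitstring n) (M C : {set bitstring n}).

Definition distance2_free M := {in M &, forall x y, hamming x y != 2}.

(** If flipping [i] lands in [M] short of [v], a second coordinate [j] still separates [u] from [v].
    The two candidates [flip u i] and [flip u j] are at distance 2, so the latter avoids [M]. *)
Lemma free_closer_neighbour M u v : distance2_free M -> 0 < hamming u v ->
  exists i, u i != v i /\ ((flip u i \in M) ==> (flip u i == v)).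
Proof.
move=> dM /hamming_gt0[i nui]; have hi := hamming_flipS nui.
case: (posnP (hamming (flip u i) v)) => [/eqP|].
  by rewrite hamming_eq0 => h; exists i; rewrite h implybT.
case/hamming_gt0=> j nuj.
have nij : i != j.
  apply: contraNneq nuj => <-; rewrite ffunE eqxx addbT.
  by move: nui; case: (u i); case: (v i).
have [iM|niM] := boolP (flip u i \in M); last by exists i; rewrite (negbTE niM).
exists j; split; first by move: nuj; rewrite ffunE [j == i]eq_sym (negbTE nij) addbF.
apply/implyP=> jM; have /hamming2P[] := dM _ _ iM jM.
by exists i, j; rewrite flipK.
Qed.

Lemma free_geodesic M u v : distance2_free M ->
  exists p, [/\ path (@hypercube n) u p, last u p = v, uniq (u :: p),
                size p = hamming u v & {in p, forall x, x \in M -> x = v}].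
Proof.
move=> dM.
(* The induction also carries that every later vertex is strictly closer to [v] than [u] is; hence
   [u] never recurs, which gives [uniq]. *)
suff: exists p, [/\ path (@hypercube n) u p, last u p = v, uniq (u :: p),
    size p = hamming u v & {in p, forall x,
      hamming x v < hamming u v /\ (x \in M -> x = v)}].
  case=> p [? ? ? ? pP]; exists p; split=> // x /pP[_]; exact.
have [k hk] : exists k, hamming u v = k by exists (hamming u v).
elim: k u hk => [|k IH] u hk.
  move/eqP: (hk); rewrite hamming_eq0 => /eqP ?; exists [::]; split=> //.
have [|i [nui uiM]] := @free_closer_neighbour M u v dM; first by rewrite hk.
have hi := hamming_flipS nui; have [hik] : (hamming (flip u i) v).+1 = k.+1.
  by rewrite -hi.
have [p [pp pl pu ps pP]] := IH _ hik.
have closer : {in flip u i :: p, forall x,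
    hamming x v < hamming u v /\ (x \in M -> x = v)}.
  move=> x; rewrite inE => /predU1P[->|/pP[xv xM]].
    by rewrite hi; split=> // /(implyP uiM)/eqP.
  by split=> //; rewrite hi ltnS ltnW.
exists (flip u i :: p); split=> //; last by rewrite /= ps hi.
- by rewrite /= hypercube_flip.
- by rewrite cons_uniq pu andbT; apply/negP=> /closer[]; rewrite ltnn.
Qed.

(** The strings [flip x i] and [flip x j] differ exactly at [i] and [j], so a first step that gets
    closer must flip one of these two coordinates. *)
Lemma common_neighbour x w i j : i != j ->
  @hypercube n (flip x i) w -> @hypercube n w (flip x j) ->
  w = x \/ w = flip (flip x i) j.
Proof.
move=> nij /hypercubeP[a ->] /hypercubeP[b] /ffunP E.
have [<-|nia] := eqVneq i a; first by left; rewrite flipK.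
right; suff -> : a = j by [].
have := E j; have := E i.
have nji : (j == i) = false by rewrite eq_sym (negbTE nij).
rewrite !ffunE !eqxx nji (negbTE nij) (negbTE nia).
have [<-|nib] := eqVneq i b; last by case: (x i).
by rewrite nji; have [->|] := eqVneq j a => //; case: (x j).
Qed.

Lemma total_mutual_visibilityP M :
  total_mutual_visibility_set (@hypercube n) M <-> distance2_free M.
Proof.
split=> [vM x y xM yM|dM u v].
- apply/hamming2P=> -[i [j [nij yE]]].
  (* The blocked pair is [flip x i], [flip x j]: its only common neighbours are [x] and [y], both in
     [M]. *)
  have uv2 : hamming (flip x i) (flip x j) = 2.
    by apply/eqP/hamming2P; exists i, j; rewrite flipK.
  have [p [[/and3P[pp /eqP pl _] pmin] pfree]] := vM (flip x i) (flip x j).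
  (* At least 2 by the Hamming distance, at most 2 by comparison with the path through [x]. *)
  have ps : size p = 2.
    apply/eqP; rewrite eqn_leq -{2}uv2 -pl hamming_path // andbT.
    apply: (pmin [:: x; flip x j]).
    rewrite /uv_path /= hypercube_flip /hypercube hamming_sym hamming_flip eqxx /=.
    rewrite !inE negb_or andbT -!hamming_eq0 uv2 hamming_flip.
    by rewrite hamming_eq0 eqxx [hamming _ x]hamming_sym hamming_flip.
  case: p ps pp pl pfree {pmin} => [|w [|z []]] //= _ /and3P[uw wz _] zE pfree.
  rewrite {z}zE in wz pfree.
  have wM : w \in M by case: (common_neighbour nij uw wz) => ->; rewrite -?yE.
  (* Being in [M], the middle vertex [w] must be an endpoint, which would make one of the two edges
     a loop. *)
  have := pfree w; rewrite !inE eqxx orbT => /(_ isT); rewrite wM andbT negbK.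
  by case/orP=> /eqP wE; move: uw wz; rewrite wE hypercube_irr.
- have [p [pp pl pu ps pP]] := free_geodesic u v dM.
  exists p; split; first split.
  + by rewrite /uv_path pp pl eqxx pu.
  + by move=> q /and3P[qp /eqP ql _]; rewrite ps -ql hamming_path.
  move=> x; rewrite !inE => /predU1P[->|/pP xP]; first by rewrite eqxx.
  apply/negP=> /andP[+ /xP xv]; by rewrite xv eqxx orbT.
Qed.

(** Equal parity makes distances even; with 0 and 2 excluded, at least 4 remains. *)
Lemma parity_class_code M b : distance2_free M ->
  code_distance_ge 4 [set x in M | parity x == b].
Proof.
move=> dM; apply/forall_inP=> x; rewrite inE => /andP[xM /eqP xb].
apply/forall_inP=> y; rewrite inE => /andP[yM /eqP yb].
apply/implyP; rewrite -hamming_eq0.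
have := dM _ _ xM yM; have := odd_hamming x y; rewrite xb yb addbb.
by case: (hamming x y) => [|[|[|[|]]]].
Qed.

Lemma distance2_free_card M : distance2_free M -> #|M| <= 2 * A n 4.
Proof.
move=> dM; have card_le b : #|[set x in M | parity x == b]| <= A n 4.
  apply: (@leq_bigmax_cond _ _ (fun C : {set bitstring n} => #|C|)).
  exact: parity_class_code.
rewrite mul2n -addnn -(cardsID [set x | parity x == true] M).
apply: leq_add; [have := card_le true | have := card_le false];
  congr (_ <= _); apply: eq_card => x; rewrite !inE //.
by case: (parity x); rewrite ?andbF ?andbT.
Qed.

Lemma code_dist C x y : code_distance_ge 4 C -> x \in C -> y \in C ->
  x = y \/ 4 <= hamming x y.
Proof.
move=> /forall_inP/(_ x) cC xC yC; have /forall_inP/(_ y yC)/implyP := cC xC.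
by have [|_ /(_ isT)] := eqVneq x y; [left | right].
Qed.

Definition doubled_code i C := C :|: [set flip x i | x in C].

(** Flipping [i] in both words preserves distance. Flipping it in one word gives distance 1 if the
    codewords coincide and at least 4 - 1 = 3 otherwise. *)
Lemma doubled_code_distance2_free i C :
  code_distance_ge 4 C -> distance2_free (doubled_code i C).
Proof.
move=> cC.
have far x y : x \in C -> y \in C -> hamming x y != 2.
  move=> xC yC; case: (code_dist cC xC yC) => [->|].
    by have /eqP-> : hamming y y == 0 by rewrite hamming_eq0.
  by case: (hamming x y) => [|[|[]]].
have mixed x y : x \in C -> y \in C -> hamming x (flip y i) != 2.
  move=> xC yC; case: (code_dist cC xC yC) => [->|]; first by rewrite hamming_flip.
  have := hamming_triangle x (flip y i) y.
  rewrite (hamming_sym (flip y i)) hamming_flip => le h4.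
  by apply: contraTneq (leq_trans h4 le) => ->.
move=> x y; rewrite !inE => /orP[xC|/imsetP[x' x'C ->]] /orP[yC|/imsetP[y' y'C ->]].
- exact: far.
- exact: mixed.
- by rewrite hamming_sym mixed.
- by rewrite hamming_flip2 far.
Qed.

Lemma card_doubled_code i C : code_distance_ge 4 C -> #|doubled_code i C| = 2 * #|C|.
Proof.
move=> cC; rewrite cardsU card_imset; last first.
  by move=> x y /(congr1 (fun z => flip z i)); rewrite !flipK.
(* A codeword in the translate would be at distance 1 from a codeword. *)
rewrite (_ : _ :&: _ = set0) ?cards0 ?subn0 ?addnn ?mul2n //.
apply/eqP; rewrite setI_eq0; apply/pred0P=> x /=; apply/negP=> /andP[xC /imsetP[y yC xE]].
case: (code_dist cC xC yC) => h; move: (hamming_flip y i); rewrite -xE.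
  by have /eqP-> : hamming y x == 0 by rewrite hamming_eq0 h.
by rewrite hamming_sym => h1; rewrite h1 in h.
Qed.

End TotalVisibility.

Theorem theorem3p10 (h : nat) (hh : 1 <= h) :
  mu_t (@hypercube h) = 2 * A h 4.
Proof.
apply/eqP; rewrite eqn_leq; apply/andP; split.
  by apply/bigmax_leqP=> M /asboolP/total_mutual_visibilityP; exact: distance2_free_card.
(* The empty code makes the family nonempty, so the maximum [A h 4] is attained. *)
have code0 : code_distance_ge 4 (set0 : {set bitstring h}).
  by apply/forall_inP=> x; rewrite inE.
have [|C cC AE] := @eq_bigmax_cond _ [pred C | @code_distance_ge h 4 C] (fun C => #|C|).
  by apply/card_gt0P; exists set0.
(* Here [1 <= h] supplies coordinate 0 as the direction of the translation. *)
rewrite [A h 4]AE -(card_doubled_code (Ordinal hh) cC).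
apply: (@leq_bigmax_cond _ _ (fun M : {set bitstring h} => #|M|)).
exact/asboolP/total_mutual_visibilityP/doubled_code_distance2_free.
Qed.
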